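(* Let $\mathbf{a}=(a_n)_{n\ge0}$ be a sequence in $\mathbb{F}_q$ which is not ultimately periodic, and put $\xi:=\sum_{n=0}^\infty a_nT^{-n}$. Assume there are integers $n_0\ge1$ and $\kappa\ge2$ such that $p(\mathbf{a},n)\le\kappa n$ for all $n\ge n_0$. If $\mathrm{Dio}(\mathbf{a})$ is finite, then $w_1(\xi)\le8(\kappa+1)^2(2\kappa+1)\mathrm{Dio}(\mathbf{a})-1$.
   Context: $p$ prime, $q$ a power of $p$; $\mathbb{F}_q((T^{-1}))$ with $|\sum_{n\ge N}a_nT^{-n}|=q^{-N}$ ($a_N\ne0$). $H(P)$ is the maximum absolute value of the coefficients of $P\in(\mathbb{F}_q[T])[X]$; $w_1(\xi)$ is the supremum of $w$ such that $0<|P(\xi)|\le H(P)^{-w}$ for infinitely many $P\in(\mathbb{F}_q[T])[X]$ of degree at most $1$. $p(\mathbf{a},n)$ is the number of distinct words $a_ia_{i+1}\cdots a_{i+n-1}$, $i\ge0$. Words: $W^w=W^{\lfloor w\rfloor}W'$ with $W'$ the prefix of $W$ of length $\lceil(w-\lfloor w\rfloor)|W|\rceil$. $\mathbf{a}$ satisfies $( * )_\rho$ if there are finite words $U_n,V_n$ and reals $w_n\ge0$ with $U_nV_n^{w_n}$ a prefix of $\mathbf{a}$, $|U_nV_n^{w_n}|/|U_nV_n|\ge\rho$, and $(|V_n^{w_n}|)_n$ strictly increasing; $\mathrm{Dio}(\mathbf{a})$ is the supremum of such $\rho$. *)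

(* Defs.v *)
From HB Require Import structures.
From mathcomp Require Import all_boot all_order all_algebra finmap.
From mathcomp Require Import all_classical all_reals all_analysis.
From mathcomp Require Import zify.
Set Implicit Arguments.
Unset Strict Implicit.
Unset Printing Implicit Defensive.
Import Order.TTheory GRing.Theory Num.Theory.
Local Open Scope classical_set_scope.
Local Open Scope ring_scope.

(* A formal Laurent series in T^-1 is a function f : int -> F vanishing far
   enough to the left, where f n is the coefficient of T^-n. *)
Section Laurent.
Variable F : fieldType.

Definition is_laurent : pred (int -> F) :=
  fun f => `[< exists N : int, forall n, n < N -> f n = 0 >].

Lemma is_laurentP f :
  reflect (exists N : int, forall n, n < N -> f n = 0) (f \in is_laurent).
Proof. exact: asboolP. Qed.

Fact is_laurent_zmod_closed : zmod_closed is_laurent.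
Proof.
split; first by apply/is_laurentP; exists 0.
move=> f g /is_laurentP[M fM] /is_laurentP[N gN].
apply/is_laurentP; exists (Num.min M N) => n; rewrite lt_min => /andP[nM nN].
by rewrite /GRing.add /GRing.opp /= fM // gN // oppr0 addr0.
Qed.

HB.instance Definition _ :=
  GRing.isZmodClosed.Build (int -> F) is_laurent is_laurent_zmod_closed.

Record laurent := Laurent {
  lcoef :> int -> F;
  laurentP : lcoef \in is_laurent }.

HB.instance Definition _ := [isSub for lcoef].
HB.instance Definition _ := [Choice of laurent by <:].
HB.instance Definition _ := [SubChoice_isSubZmodule of laurent by <:].

Lemma laurent_ext (f g : laurent) : (forall n, f n = g n) -> f = g.
Proof. by move=> fg; apply/val_inj/funext. Qed.

Lemma lcoefD (f g : laurent) n : (f + g) n = f n + g n.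
Proof. by []. Qed.

Lemma lcoefB (f g : laurent) n : (f - g) n = f n - g n.
Proof. by []. Qed.

Lemma lcoef0 n : (0 : laurent) n = 0.
Proof. by []. Qed.

Lemma laurent_bound (f : laurent) :
  exists N : int, forall n, n < N -> f n = 0.
Proof. exact/is_laurentP/laurentP. Qed.

Lemma laurent_bound3 (f g h : laurent) : exists N : int,
  [/\ forall n, n < N -> f n = 0, forall n, n < N -> g n = 0
    & forall n, n < N -> h n = 0].
Proof.
have [a fa] := laurent_bound f; have [b gb] := laurent_bound g.
have [c hc] := laurent_bound h.
by exists (Num.min a (Num.min b c)); split => n; rewrite !lt_min => /and3P[*];
  [apply: fa|apply: gb|apply: hc].
Qed.

(* The sum is over all i in int; its support is finite by laurent_bound. *)
Definition lmul_fun (f g : int -> F) (n : int) : F :=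
  \sum_(i \in [set: int]) f i * g (n - i).

Definition zbox (a b : int) : {fset int} :=
  [fset (a + k%:Z)%R | k in iota 0 (`|b - a|%N).+1]%fset.

Lemma in_zbox a b (i : int) : a <= i -> i <= b -> i \in zbox a b.
Proof.
move=> ai ib; apply/imfsetP; exists `|i - a|%N => /=; last by lia.
rewrite inE mem_iota; lia.
Qed.

Lemma fsum_box (G : int -> F) a b :
    (forall i, G i != 0 -> (a <= i) && (i <= b)) ->
  \sum_(i \in [set: int]) G i = \sum_(i <- zbox a b) G i.
Proof.
move=> Gab; apply: fsbigTE => i; apply: contraNeq => /Gab/andP[]; exact: in_zbox.
Qed.

Lemma lmul_box (f g : int -> F) (N n : int) :
    (forall n, n < N -> f n = 0) -> (forall n, n < N -> g n = 0) ->
  lmul_fun f g n = \sum_(i <- zbox N (n - N)) f i * g (n - i).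
Proof.
move=> fN gN; apply: fsum_box => i; rewrite mulf_eq0 negb_or => /andP[fi gi].
apply/andP; split.
  by rewrite leNgt; apply: contra fi => /fN ->.
by rewrite lerBrDr -lerBrDl leNgt; apply: contra gi => /gN ->.
Qed.

Fact lmul_subproof (f g : laurent) : lmul_fun f g \in is_laurent.
Proof.
have [N [fN gN _]] := laurent_bound3 f g f.
apply/is_laurentP; exists (N + N) => n nN.
rewrite (lmul_box _ fN gN) big1 // => i _.
have [iN|iN] := ltP i N; first by rewrite fN // mul0r.
by rewrite (gN (n - i)) ?mulr0 //; lia.
Qed.

Definition lmul (f g : laurent) : laurent := Laurent (lmul_subproof f g).

Fact lone_subproof : (fun n : int => (n == 0)%:R) \in is_laurent.
Proof. by apply/is_laurentP; exists 0 => n; case: ltgtP. Qed.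

Definition lone : laurent := Laurent lone_subproof.

Lemma lmulC : commutative lmul.
Proof.
move=> f g; apply: laurent_ext => n /=; rewrite /lmul_fun.
rewrite (reindex_fsbigT (fun i => n - i)) /=.
  by apply: eq_fsbigr => i _; rewrite mulrC subKr.
by exists (fun i => n - i) => i; rewrite subKr.
Qed.

Lemma lmulA : associative lmul.
Proof.
move=> f g h; apply: laurent_ext => n /=; rewrite /lmul_fun.
have [N [fN gN hN]] := laurent_bound3 f g h.
pose G i j := f j * g (i - j) * h (n - i).
have G0 i j : G i j != 0 -> [/\ N <= j, N <= i - j & N <= n - i].
  rewrite !mulf_eq0 !negb_or => /andP[/andP[fj gij] hni].
  by split; rewrite leNgt; [apply: contra fj => /fN ->
    |apply: contra gij => /gN -> |apply: contra hni => /hN ->].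
transitivity (\sum_(j \in [set: int]) \sum_(i \in [set: int]) G i j).
  apply: eq_fsbigr => j _; rewrite mulr_fsumr.
  rewrite [RHS](reindex_fsbigT (fun i => i + j)) /=; last first.
    by exists (fun i => i - j) => i; rewrite ?addrK ?subrK.
  apply: eq_fsbigr => i _; rewrite /G addrK mulrA.
  by rewrite (_ : n - (i + j) = n - j - i) //; lia.
transitivity (\sum_(i \in [set: int]) \sum_(j \in [set: int]) G i j); last first.
  by apply: eq_fsbigr => i _; rewrite mulr_fsuml.
have Gj j : \sum_(i \in [set: int]) G i j =
    \sum_(i <- zbox (N + N) (n - N)) G i j.
  by apply: fsum_box => i /G0[]; lia.
have Gi i : \sum_(j \in [set: int]) G i j =
    \sum_(j <- zbox N (n - N - N)) G i j.
  by apply: fsum_box => j /G0[]; lia.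
under [LHS]eq_fsbigr do rewrite Gj.
under [RHS]eq_fsbigr do rewrite Gi.
rewrite (@fsum_box _ N (n - N - N)); last first.
  move=> j; have [//|jN] := boolP ((_ <= j) && _).
  rewrite big1 ?eqxx // => i _; apply/eqP; apply: contraNT jN => /G0[]; lia.
rewrite (@fsum_box _ (N + N) (n - N)); last first.
  move=> i; have [//|iN] := boolP ((_ <= i) && _).
  rewrite big1 ?eqxx // => j _; apply/eqP; apply: contraNT iN => /G0[]; lia.
exact: exchange_big.
Qed.

Lemma lmul1 : left_id lone lmul.
Proof.
move=> f; apply: laurent_ext => n /=; rewrite /lmul_fun.
rewrite (fsbigTE [fset (0:int)]%fset) ?big_seq_fset1 ?mul1r ?subr0 // => i.
by rewrite inE => /negPf ->; rewrite mul0r.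
Qed.

Lemma lmulDl : left_distributive lmul +%R.
Proof.
move=> f g h; apply: laurent_ext => n; rewrite lcoefD /=.
have [N [fN gN hN]] := laurent_bound3 f g h.
have fgN i : i < N -> (f + g) i = 0.
  by move=> iN; rewrite lcoefD fN // gN // addr0.
rewrite (lmul_box _ fN hN) (lmul_box _ gN hN) (lmul_box _ fgN hN).
by rewrite -big_split /=; apply: eq_bigr => i _; rewrite -mulrDl.
Qed.

Lemma lone_neq0 : lone != 0.
Proof.
by apply/eqP => /(congr1 (fun f : laurent => f 0)) /eqP; rewrite /= oner_eq0.
Qed.

HB.instance Definition _ := GRing.Zmodule_isComNzRing.Build laurent
  lmulA lmulC lmul1 lmulDl lone_neq0.

Lemma lcoefM (f g : laurent) n :
  (f * g) n = \sum_(i \in [set: int]) f i * g (n - i).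
Proof. by []. Qed.

(* Polynomials in T: the coefficient p`_k of T^k sits at index - k. *)
Definition lpoly_fun (p : {poly F}) (n : int) : F :=
  if n <= 0 then p`_`|n|%N else 0.

Fact lpoly_subproof (p : {poly F}) : lpoly_fun p \in is_laurent.
Proof.
suff p0 (n : int) : n < - (size p)%:Z -> lpoly_fun p n = 0.
  by apply/is_laurentP; exists (- (size p)%:Z).
by rewrite /lpoly_fun; case: ifP => // _ np; rewrite nth_default //; move: (size p) np => m np; lia.
Qed.

Definition lpoly (p : {poly F}) : laurent := Laurent (lpoly_subproof p).

Fact lpoly_zmod_morphism : zmod_morphism lpoly.
Proof.
move=> p q; apply: laurent_ext => n; rewrite lcoefB /= /lpoly_fun.
by case: ifP; rewrite ?coefB ?subr0.
Qed.

Fact lpoly_monoid_morphism : monoid_morphism lpoly.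
Proof.
split; first apply: laurent_ext => n.
  by rewrite /= /lpoly_fun coef1; case: ifP => //; case: n => [[]|].
move=> p q; apply: laurent_ext => n; rewrite lcoefM /= /lpoly_fun.
case: ifP => n0; last first.
  rewrite (@fsum_box _ 1 0) ?big1 // => i.
    by case: ifP => i0; [case: ifP => ?; [lia|rewrite mulr0]|rewrite mul0r].
  by case: ifP => i0; rewrite ?mul0r ?eqxx //; case: ifP => i1;
    rewrite ?mulr0 ?eqxx //; lia.
rewrite coefM -(big_mkord xpredT (fun i => p`_i * q`_(`|n| - i))).
rewrite (fsbigTE [fset (- k%:Z)%R | k in iota 0 `|n|%N.+1]%fset).
  rewrite big_imfset; last by move=> i j _ _; lia.
  rewrite [RHS](perm_big (iota 0 `|n|%N.+1)); last first.
    apply: uniq_perm; [exact: enum_finmem_uniq|exact: iota_uniq|move=> i].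
    by rewrite enum_finmemE.
  rewrite /index_iota subn0; apply: eq_big_seq => i; rewrite mem_iota => i_n.
  by rewrite !ifT; [congr (p`_ _ * q`_ _); lia|lia|lia].
move=> i iP; case: ifP => i0; last by rewrite mul0r.
case: ifP => ni; last by rewrite mulr0.
case/negP: iP; apply/imfsetP; exists `|i|%N => /=; last by lia.
rewrite inE mem_iota; lia.
Qed.

HB.instance Definition _ :=
  GRing.isZmodMorphism.Build {poly F} laurent lpoly lpoly_zmod_morphism.
HB.instance Definition _ :=
  GRing.isMonoidMorphism.Build {poly F} laurent lpoly lpoly_monoid_morphism.

Definition lseries_fun (a : nat -> F) (n : int) : F :=
  if n is Posz k then a k else 0.

Fact lseries_subproof (a : nat -> F) : lseries_fun a \in is_laurent.
Proof. by apply/is_laurentP; exists 0; case. Qed.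

(* \sum_(n >= 0) a_n T^-n *)
Definition lseries (a : nat -> F) : laurent := Laurent (lseries_subproof a).

(* The index N of the leading term a_N T^-N (0 for the zero series). *)
Definition lval (f : laurent) : int :=
  xget 0 [set N : int | f N != 0 /\ forall n, n < N -> f n = 0].

Lemma lvalP (f : laurent) :
  f != 0 -> f (lval f) != 0 /\ forall n, n < lval f -> f n = 0.
Proof.
move=> f0; rewrite /lval; case: xgetP => [N _ //|noN]; exfalso.
have [N fN] := laurent_bound f.
have [n fn] : exists n, f n != 0.
  apply: contrapT => f_0; case/eqP: f0; apply: laurent_ext => n.
  by apply/eqP; apply: contrapT => fn; apply: f_0; exists n; apply/negP.
have exk : exists k : nat, f (N + k%:Z) != 0.
  exists `|n - N|%N.
  suff -> : N + `|n - N|%N%:Z = n by [].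
  have : N <= n by rewrite leNgt; apply: contra fn => /fN ->.
  lia.
case: (ex_minnP exk) => k fk kmin; apply: (noN (N + k%:Z)); split => // m mk.
have [/fN //|Nm] := ltP m N.
apply/eqP; apply: contraT => fm.
have := kmin `|m - N|%N; rewrite (_ : N + _ = m) ?fm; last by lia.
by move=> /(_ isT); lia.
Qed.

End Laurent.

Section Exponents.
Variables (R : realType) (F : finFieldType).

Definition labs (f : laurent F) : R :=
  if f == 0 then 0 else #|F|%:R ^ (- lval f).

Definition height (P : {poly {poly F}}) : R :=
  \big[Num.max/0]_(i < size P) labs (lpoly P`_i).

Definition leval (P : {poly {poly F}}) (xi : laurent F) : laurent F :=
  (map_poly (@lpoly F) P).[xi].

Definition w1 (xi : laurent F) : \bar R :=
  ereal_sup [set w%:E | w in [set w : R |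
    infinite_set [set P : {poly {poly F}} | (size P <= 2)%N /\
      0 < labs (leval P xi) <= height P `^ (- w)]]].

End Exponents.

Section Words.
Variable T : Type.

Definition word_at (a : nat -> T) (i n : nat) : seq T :=
  mkseq (fun k => a (i + k)%N) n.

Definition is_prefix (s : seq T) (a : nat -> T) : Prop :=
  s = word_at a 0 (size s).

Definition ultimately_periodic (a : nat -> T) : Prop :=
  exists N p : nat, (0 < p)%N /\ forall n, (N <= n)%N -> a (n + p)%N = a n.

(* W^w, meant for w >= 0, where truncn is the floor. *)
Definition word_pow (R : realType) (W : seq T) (w : R) : seq T :=
  flatten (nseq (Num.truncn w) W) ++
  take `|Num.ceil ((w - (Num.truncn w)%:R) * (size W)%:R)|%N W.

(* Condition ( * )_rho.  If U_n V_n is empty (possible only for n = 0) the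
   ratio is 0 / 0 = 0; dropping that first term does not affect Dio. *)
Definition dio_cond (R : realType) (a : nat -> T) (rho : R) : Prop :=
  exists (U V : nat -> seq T) (w : nat -> R),
    [/\ forall n, 0 <= w n,
        forall n, is_prefix (U n ++ word_pow (V n) (w n)) a,
        forall n, rho <= (size (U n ++ word_pow (V n) (w n)))%:R /
                         (size (U n ++ V n))%:R
      & {homo (fun n => size (word_pow (V n) (w n))) : m n / (m < n)%N}].

Definition Dio (R : realType) (a : nat -> T) : \bar R :=
  ereal_sup [set rho%:E | rho in [set rho : R | dio_cond a rho]].

End Words.

Definition complexity (T : finType) (a : nat -> T) (n : nat) : nat :=
  #|[pred u : n.-tuple T | `[< exists i, tval u = word_at a i n >]]|.

(* Main.v *)
Require Import Defs.
From mathcomp Require Import all_boot all_order all_algebra finmap.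
From mathcomp Require Import all_classical all_reals all_analysis.
From mathcomp Require Import zify ring.
(** Let [P = q X + p] be a linear form with [|P(xi)| <= H(P)^-w], and let [d] be
    the degree of [q].  Low complexity and the pigeonhole principle give
    [i < j <= kappa (d + 1)] such that the same word of length [d + 1] occurs
    in [a] at [i] and at [j], so that [Q = T^j - T^i] satisfies
    [|Q xi - Pn| < 1 / |q|] for some polynomial [Pn].  If [w > 2 kappa], the
    polynomial [q Pn + p Q] has absolute value less than 1 and hence vanishes:
    [-p / q = Pn / Q], and [|Q xi - Pn|] is as small as [|Q P(xi) / q|].  This means
    that [a] has period [j - i] from index [i] up to index [(w + 1) d], whence
    [Dio a >= (w + 1) / (2 kappa)]; this is stronger than what is claimed. *)

Set Implicit Arguments.
Unset Strict Implicit.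
Unset Printing Implicit Defensive.
Import Order.TTheory GRing.Theory Num.Theory.
Local Open Scope ring_scope.

(** * Coefficients of products with polynomials in [T] *)

Lemma lcoef_sum (F : fieldType) (I : Type) (r : seq I) (G : I -> laurent F) m :
  lcoef (\sum_(i <- r) G i) m = \sum_(i <- r) lcoef (G i) m.
Proof. by elim/big_rec2: _ => // i x y _ <-; rewrite lcoefD. Qed.

Lemma lcoef_monoM (F : fieldType) (c : F) (k : nat) (g : laurent F) (m : int) :
  (lpoly (c *: 'X^k) * g) m = c * g (m + k%:Z).
Proof.
rewrite lcoefM (fsbigTE [fset (- k%:Z)%R]%fset) => [|i].
  rewrite big_seq_fset1 opprK /= /lpoly_fun ifT; last by lia.
  by rewrite abszN absz_nat coefZ coefXn eqxx mulr1.
rewrite inE /= /lpoly_fun => ik; case: ifP => i0; last by rewrite mul0r.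
rewrite coefZ coefXn (_ : (_ == k) = false) ?mulr0 ?mul0r //.
by apply/negbTE; apply: contra ik => /eqP <-; apply/eqP; lia.
Qed.

Lemma lcoef_polyM (F : fieldType) (q : {poly F}) (g : laurent F) (m : int) :
  (lpoly q * g) m = \sum_(k < size q) q`_k * g (m + k%:Z).
Proof.
rewrite -{1}[q]coefK poly_def rmorph_sum mulr_suml lcoef_sum.
by apply: eq_bigr => k _; rewrite lcoef_monoM.
Qed.

Lemma lcoef_lpoly (F : fieldType) (q : {poly F}) (k : nat) :
  lpoly q (- k%:Z) = q`_k.
Proof. by rewrite /= /lpoly_fun ifT ?abszN ?absz_nat //; lia. Qed.

Lemma lcoef_lpoly_gt0 (F : fieldType) (q : {poly F}) (m : int) :
  0 < m -> lpoly q m = 0.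
Proof. by move=> m0; rewrite /= /lpoly_fun ifF //; apply/negbTE; rewrite -ltNge. Qed.

(** * Linear forms with small value at [xi] *)

Lemma leval_linear (F : finFieldType) (P : {poly {poly F}}) (xi : laurent F) :
  (size P <= 2)%N -> leval P xi = lpoly P`_1 * xi + lpoly P`_0.
Proof.
move=> P2; rewrite /leval (@horner_coef_wide _ 2); last first.
  exact: leq_trans (size_poly _ _) P2.
by rewrite big_ord_recl big_ord1 expr0 mulr1 expr1 !coef_map addrC.
Qed.

Lemma lval_lpoly (F : fieldType) (q : {poly F}) :
  q != 0 -> lval (lpoly q) = - (size q).-1%:Z.
Proof.
move=> q0.
have lq : lpoly q (- (size q).-1%:Z) != 0.
  by rewrite lcoef_lpoly -lead_coefE lead_coef_eq0.
have l0 : lpoly q != 0 by apply: contraNneq lq => ->.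
have [v1 v2] := @lvalP _ _ l0.
apply/eqP; rewrite eq_le; apply/andP; split.
  by rewrite leNgt; apply: contra lq => /v2 ->.
rewrite leNgt; apply: contra v1 => vq.
set m := lval _ in vq *.
rewrite (_ : m = - `|m|%N%:Z); last by lia.
rewrite lcoef_lpoly nth_default //.
move: (size q) vq => s; lia.
Qed.

Lemma coef_le_height (R : realType) (F : finFieldType) (P : {poly {poly F}}) i :
  P`_i != 0 -> (#|F|%:R : R) ^+ (size P`_i).-1 <= height R P.
Proof.
move=> Pi0; have iP : (i < size P)%N.
  by rewrite ltnNge; apply: contra Pi0 => /leq_sizeP ->.
rewrite /height; apply: (@le_trans _ _ (labs R (lpoly P`_i))); last first.
  exact: (le_bigmax _ (fun i : 'I_(size P) => labs R (lpoly P`_i)) (Ordinal iP)).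
have : lpoly P`_i != 0.
  apply: contra Pi0 => /eqP h; rewrite -lead_coef_eq0 lead_coefE -lcoef_lpoly.
  by rewrite h.
by rewrite /labs => /negPf ->; rewrite lval_lpoly // opprK.
Qed.

(** If the coefficient of index [i] has degree [d] in [T], the height is at least [#|F| ^ d].
    Comparing exponents of [#|F|] shows that a nonzero value has its leading index at [w * d] or
    later. *)
Lemma leval_small_coef (R : realType) (F : finFieldType) (P : {poly {poly F}})
    (xi : laurent F) (w : R) i :
  0 <= w -> labs R (leval P xi) <= height R P `^ (- w) -> P`_i != 0 ->
  forall m : int, m%:~R < w * (size P`_i).-1%:R -> leval P xi m = 0.
Proof.
move=> w0 fH Pi0 m mw; set f := leval P xi in fH *.
have [->//|f0] := eqVneq f 0.
have [_ v2] := @lvalP _ _ f0; apply: v2; rewrite -(ltr_int R).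
apply: (lt_le_trans mw).
have cF : 1 < #|F|%:R :> R by rewrite ltr1n card_finNzRing_gt1.
have cF0 : 0 < #|F|%:R :> R by apply: lt_trans cF.
have := coef_le_height R Pi0; set d := (size _).-1 => dH.
have H0 : 0 < height R P by apply: lt_le_trans dH; rewrite exprn_gt0.
have : #|F|%:R `^ (- (lval f)%:~R) <= #|F|%:R `^ (- (w * d%:R)) :> R.
  have -> : #|F|%:R `^ (- (lval f)%:~R) = labs R f.
    by rewrite /labs (negPf f0) -mulrNz powR_intmul // ltW.
  apply: (le_trans fH).
  rewrite mulrC -mulrN powRrM powR_mulrn ?(ltW cF0) //.
  rewrite !powRN lef_pV2 ?posrE ?powR_gt0 ?exprn_gt0 //.
  by apply: ge0_ler_powR => //; rewrite nnegrE ltW // exprn_gt0.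
rewrite -ler_ln ?posrE ?powR_gt0 // !ln_powR ler_pM2r ?ln_gt0 //.
by rewrite lerN2.
Qed.

(** When the coefficient of [X] has bounded degree, smallness of the value bounds the degree of the
    constant term too. Over a finite field only finitely many such forms exist. *)
Lemma infinite_linear_large_size (R : realType) (F : finFieldType)
    (xi : laurent F) (w : R) (N : nat) :
  0 <= w -> (forall m : int, m < 0 -> xi m = 0) ->
  infinite_set [set P : {poly {poly F}} | (size P <= 2)%N /\
      0 < labs R (leval P xi) <= height R P `^ (- w)] ->
  exists P : {poly {poly F}}, [/\ (size P <= 2)%N, (N < size (P`_1)%R)%N
    & labs R (leval P xi) <= height R P `^ (- w)].
Proof.
move=> w0 xi0 infP; apply: contrapT => noP; apply: infP.
pose dec (t : {ffun 'I_2 * 'I_N.+1 -> F}) : {poly {poly F}} :=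
  \poly_(i < 2) \poly_(j < N.+1) t (inord i, inord j).
apply: (@sub_finite_set _ _ [set dec t | t in [set: {ffun 'I_2 * 'I_N.+1 -> F}]]).
  move=> P [P2 /andP[_ PH]].
  have P1N : (size (P`_1)%R <= N)%N.
    by rewrite leqNgt; apply/negP => NP; apply: noP; exists P.
  (* Vanishing is known only at negative indices, so for [N = 0] a constant term of size 1 remains
     possible; hence [N.+1]. *)
  have P0N : (size (P`_0)%R <= N.+1)%N.
    have [->|P0] := eqVneq P 0; first by rewrite coef0 size_poly0.
    have [i Pi0] : exists i, P`_i != 0.
      by exists (size P).-1; rewrite -lead_coefE lead_coef_eq0.
    have f0 m : m < 0 -> leval P xi m = 0.
      move=> m0; apply: (leval_small_coef w0 PH Pi0).
      by apply: (@lt_le_trans _ _ 0); rewrite ?ltrz0 ?mulr_ge0.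
    apply/leq_sizeP => k Nk; have := f0 (- k%:Z).
    rewrite leval_linear // lcoefD lcoef_polyM lcoef_lpoly big1 ?add0r => [|j _].
      by apply; lia.
    have jN := leq_trans (ltn_ord j) P1N.
    by rewrite xi0 ?mulr0 //; move: jN Nk; move: (nat_of_ord j) => j'; lia.
  exists [ffun u : 'I_2 * 'I_N.+1 => P`_(u.1)`_(u.2)] => //.
  apply/polyP => i; rewrite coef_poly; case: ltnP => i2; last first.
    by rewrite nth_default // (leq_trans P2).
  apply/polyP => j; rewrite coef_poly; case: ltnP => jN.
    by rewrite ffunE /= !inordK.
  rewrite nth_default //; case: i i2 => [|[|//]] _; first exact: leq_trans jN.
  exact: leq_trans (leqW P1N) jN.
exact/finite_image/finite_finset.
Qed.

(** * Repetitions forced by low complexity *)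

Lemma repeated_factor (T : finType) (a : nat -> T) (n b : nat) :
  (complexity a n <= b)%N ->
  exists i j, [/\ (i < j)%N, (j <= b)%N
    & forall k, (k < n)%N -> a (i + k)%N = a (j + k)%N].
Proof.
move=> cb.
(* Pigeonhole: the [b.+1] starting positions [0, ..., b] share at most [b] factors. *)
pose f (i : 'I_b.+1) : n.-tuple T := [tuple a (i + k)%N | k < n].
have fE i : tval (f i) = word_at a i n.
  apply: (@eq_from_nth _ (a 0)); rewrite size_tuple ?size_mkseq // => k kn.
  by rewrite nth_mkseq // -(tnth_nth _ (f i) (Ordinal kn)) tnth_mktuple.
have /injectivePn[i [j ij fij]] : ~~ injectiveb f.
  apply/negP => /injectiveP finj.
  have := card_codom finj; rewrite card_ord => cf.
  suff : (#|codom f| <= complexity a n)%N by rewrite cf ltnNge cb.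
  rewrite /complexity; apply: subset_leq_card; apply/fintype.subsetP.
  move=> u /codomP[i ->]; rewrite unfold_in /=.
  by apply/asboolP; exists i; rewrite fE.
have E k : (k < n)%N -> a (i + k)%N = a (j + k)%N.
  move=> kn; have := congr1 (fun u : n.-tuple T => tnth u (Ordinal kn)) fij.
  by rewrite !tnth_mktuple.
have /orP[l|l] : (i < j)%N || (j < i)%N by rewrite -neq_ltn.
  by exists i, j; split => //; rewrite -ltnS.
by exists j, i; split => [//||k /E //]; rewrite -ltnS.
Qed.

(** * From a repetition and a good approximation to a long period *)

Lemma lseries_neg (F : fieldType) (a : nat -> F) m : m < 0 -> lseries a m = 0.
Proof. by case: m. Qed.

Section Approximation.
Variables (F : fieldType) (a : nat -> F) (q p : {poly F}) (i j n : nat) (f : laurent F).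
Let xi := lseries a.
Hypotheses (qn : (size q <= n)%N) (ij : (i < j)%N).
Hypothesis aij : forall k, (k < n)%N -> a (i + k)%N = a (j + k)%N.
Hypothesis fE : f = lpoly q * xi + lpoly p.

Let Q : {poly F} := 'X^j - 'X^i.

Lemma lcoef_binomM (g : laurent F) m :
  (lpoly Q * g) m = g (m + j%:Z) - g (m + i%:Z).
Proof.
rewrite /Q rmorphB mulrBl lcoefB -[ 'X^j]scale1r -[ 'X^i]scale1r.
by rewrite !lcoef_monoM !mul1r.
Qed.

(* The polynomial part of [lpoly Q * xi], whose degree in [T] is at most [j]. *)
Let Pn : {poly F} := \poly_(k < j.+1) (lpoly Q * xi) (- k%:Z).
Let g : laurent F := lpoly Q * xi - lpoly Pn.

Lemma remainder_nonpos m : m <= 0 -> g m = 0.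
Proof.
move=> m0; rewrite /g lcoefB (_ : m = - `|m|%N%:Z); last by lia.
rewrite lcoef_lpoly coef_poly; case: ltnP => mj; first by rewrite subrr.
by rewrite subr0 lcoef_binomM !lseries_neg ?subrr //; lia.
Qed.

(** The dictionary between approximation and periodicity: zeros of the remainder [g] at positive
    indices are places where [a] repeats with shift [j - i]. *)
Lemma remainder_pos k : (0 < k)%N -> g k%:Z = a (j + k)%N - a (i + k)%N.
Proof.
move=> k0; rewrite /g lcoefB lcoef_lpoly_gt0 ?subr0; last by lia.
by rewrite lcoef_binomM -!PoszD /= ![(k + _)%N]addnC.
Qed.

Lemma remainder_small m : m < n%:Z -> g m = 0.
Proof.
move=> mn; have [/remainder_nonpos//|m0] := leP m 0.
rewrite (_ : m = `|m|%N); last by lia.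
by rewrite remainder_pos ?aij ?subrr //; lia.
Qed.

(** Eliminating [xi] between [q xi + p] and [Q xi - Pn] leaves a polynomial, written here in terms
    of the small quantities [f] and [g]. *)
Lemma resultantE : lpoly (q * Pn + p * Q) = lpoly Q * f - lpoly q * g.
Proof. by rewrite /g fE rmorphD !rmorphM /=; ring. Qed.

(* A polynomial in T of absolute value less than 1 is 0. *)
Lemma resultant_eq0 (W : int) :
  j%:Z < W -> (forall m, m < W -> f m = 0) -> lpoly Q * f = lpoly q * g.
Proof.
move=> jW f0; apply/eqP; rewrite -subr_eq0 -resultantE.
apply/eqP; apply: laurent_ext => m; rewrite lcoef0.
have [m0|/lcoef_lpoly_gt0//] := leP m 0.
(* For [m <= 0], the product with [Q] reads [f] at indices at most [j < W], and the product with [q]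
   reads [g] at indices below [size q <= n]. *)
rewrite resultantE lcoefB lcoef_binomM !f0 ?subrr ?sub0r; try lia.
rewrite lcoef_polyM big1 ?oppr0 // => k _.
have kn := leq_trans (ltn_ord k) qn.
by rewrite remainder_small ?mulr0 //; move: kn; move: (nat_of_ord k); lia.
Qed.

(** Leading terms in [Q f = q g] are compared: the right side starts at [lval g - deg q], while the
    left side vanishes below [W - j]. So [g] vanishes below [W - j + deg q]. *)
Lemma period_of_approximation (W : int) : q != 0 ->
  j%:Z < W -> (forall m, m < W -> f m = 0) ->
  forall k, (k + j)%:Z < W + (size q).-1%:Z -> a (i + k)%N = a (j + k)%N.
Proof.
move=> q0 jW f0 k kW.
(* The coefficient of [g] at 0 is removed by [Pn] and says nothing about [a]; [k = 0] comes from the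
   given repetition, nonempty since [q] is nonzero. *)
case: k kW => [|k] kW; first by apply: aij; apply: leq_trans qn; rewrite size_poly_gt0.
apply/esym/eqP; rewrite -subr_eq0 -remainder_pos //; apply/eqP.
have [->//|g0] := eqVneq g 0; have [v1 v2] := lvalP g0; apply: v2.
set v := lval g in v1 *.
have : (lpoly q * g) (v - (size q).-1%:Z) != 0.
  rewrite lcoef_polyM.
  have sq : ((size q).-1 < size q)%N by rewrite prednK ?size_poly_gt0.
  rewrite (bigD1 (Ordinal sq)) //= subrK big1 ?addr0 => [|l lq].
    by rewrite mulf_neq0 // -lead_coefE lead_coef_eq0.
  have {}lq : (l < (size q).-1)%N.
    have := ltn_ord l; have {lq} : nat_of_ord l != (size q).-1 by [].
    by move: (nat_of_ord l) => l'; move: (size q); lia.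
  rewrite -/g [_ (v - _ + _)](lvalP g0).2 ?mulr0 // -/v.
  by move: lq; move: (nat_of_ord l) (size q).-1; lia.
rewrite -(resultant_eq0 jW f0) lcoef_binomM => fv.
rewrite ltNge; apply: contra fv => vk.
by rewrite !f0 ?subrr //; lia.
Qed.

End Approximation.

(** * Periodic runs as fractional powers of words *)

Lemma word_at_add (T : Type) (a : nat -> T) i m n :
  word_at a i (m + n) = word_at a i m ++ word_at a (i + m) n.
Proof.
rewrite /word_at /mkseq iotaD map_cat add0n -[in X in _ ++ X](addn0 m) iotaDl -map_comp.
by congr cat; apply: eq_map => k /=; rewrite addnA.
Qed.

Lemma word_at_periodic (T : Type) (a : nat -> T) i r t s :
  (forall k, (k + r < t * r + s)%N -> a (i + (k + r))%N = a (i + k)%N) ->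
  (s <= r)%N ->
  word_at a i (t * r + s) =
    flatten (nseq t (word_at a i r)) ++ take s (word_at a i r).
Proof.
move=> per sr; elim: t per => [|t IH] per.
  by rewrite mul0n add0n -[in RHS](subnKC sr) word_at_add take_size_cat ?size_mkseq.
rewrite mulSn -addnA word_at_add /= -catA -IH => [|k kt]; last first.
  by apply: per; lia.
congr cat; apply/eq_in_map => k; rewrite mem_iota => /andP[_ kt].
by rewrite -addnA (addnC r) per //; move: kt; rewrite add0n mulSn; lia.
Qed.

(** With exponent [l / size V], the fractional part times [size V] is the integer [l %% size V], so
    the ceiling adds no letter. *)
Lemma word_pow_div (R : realType) (T : Type) (V : seq T) (l : nat) :
  (0 < size V)%N ->
  word_pow V (l%:R / (size V)%:R : R) =
    flatten (nseq (l %/ size V) V) ++ take (l %% size V) V.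
Proof.
move=> V0; rewrite /word_pow.
have V0R : 0 < (size V)%:R :> R by rewrite ltr0n.
have -> : Num.truncn (l%:R / (size V)%:R : R) = (l %/ size V)%N.
  apply: truncn_def.
  rewrite ler_pdivlMr // ltr_pdivrMr // -!natrM ler_nat ltr_nat leq_trunc_div /=.
  by rewrite ltn_ceil.
rewrite mulrBl divfK ?gt_eqF // -natrM.
have -> : l%:R - (l %/ size V * size V)%:R = (l %% size V)%N%:Z%:~R :> R.
  by rewrite -natrB ?leq_trunc_div // {1}(divn_eq l (size V)) addKn.
by rewrite intrKceil.
Qed.

Lemma size_word_pow_div (R : realType) (T : Type) (V : seq T) (l : nat) :
  (0 < size V)%N -> size (word_pow V (l%:R / (size V)%:R : R)) = l.
Proof.
move=> V0; rewrite word_pow_div // size_cat size_takel; last by rewrite ltnW // ltn_pmod.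
rewrite size_flatten /shape map_nseq sumn_nseq mulnC -divn_eq //.
Qed.

Lemma is_prefix_word_pow (R : realType) (T : Type) (a : nat -> T) (i j L : nat) :
  (i < j)%N -> (i <= L)%N ->
  (forall k, (j + k < L)%N -> a (i + k)%N = a (j + k)%N) ->
  is_prefix (word_at a 0 i ++
    word_pow (word_at a i (j - i)) ((L - i)%:R / (j - i)%:R : R)) a.
Proof.
move=> ij iL per.
have V0 : size (word_at a i (j - i)) = (j - i)%N by rewrite size_mkseq.
have r0 : (0 < j - i)%N by rewrite subn_gt0.
suff -> : word_pow (word_at a i (j - i)) ((L - i)%:R / (j - i)%:R : R) =
    word_at a (0 + i) (L - i).
  by rewrite -word_at_add /is_prefix size_mkseq.
rewrite -{2}V0 word_pow_div V0 // -word_at_periodic -?divn_eq //; last first.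
  by rewrite ltnW // ltn_pmod.
move=> k kL.
rewrite (_ : i + (k + (j - i)) = j + k)%N; last by lia.
by rewrite -per //; lia.
Qed.

(** * Lower bounds for the Diophantine exponent *)

Lemma dio_cond_of_periods (R : realType) (T : Type) (a : nat -> T) (rho : R) :
  (forall N, exists i j L, [/\ (i < j)%N, (N + i <= L)%N,
     forall k, (j + k < L)%N -> a (i + k)%N = a (j + k)%N
     & rho * j%:R <= L%:R]) ->
  dio_cond a rho.
Proof.
move=> per; pose good (N : nat) (t : nat * nat * nat) :=
  let: (i, j, L) := t in [/\ (i < j)%N, (N + i <= L)%N,
     forall k, (j + k < L)%N -> a (i + k)%N = a (j + k)%N
     & rho * j%:R <= L%:R].
have /choice[h hP] N : exists t, good N t.
  by have [i [j [L ?]]] := per N; exists (i, j, L).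
pose len (t : nat * nat * nat) := (t.2 - t.1.1)%N.
(* Each run is requested longer than the previous one, which makes the lengths strictly
   increasing. *)
pose s := fix s n := if n is m.+1 then h (len (s m)).+1 else h 0%N.
have sP n : good 0%N (s n).
  case: n => [|n]; first exact: hP.
  have := hP (len (s n)).+1; rewrite -[h _]/(s n.+1).
  by case: (s n.+1) => [[i j] L] [? ? ? ?]; split => //; lia.
have slen n : (len (s n) < len (s n.+1))%N.
  have := hP (len (s n)).+1; rewrite -[h _]/(s n.+1).
  by case: (s n.+1) => [[i j] L] [? ? ? ?]; rewrite {2}/len /=; lia.
pose V n := let: (i, j, L) := s n in word_at a i (j - i).
pose w n : R := let: (i, j, L) := s n in (L - i)%:R / (j - i)%:R.
have szV n : size (word_pow (V n) (w n)) = len (s n).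
  rewrite /V /w; case: (s n) (sP n) => [[i j] L] [ij iL _ _].
  rewrite -[in X in _ / X](size_mkseq (fun k => a (i + k)%N) (j - i)).
  by rewrite size_word_pow_div // size_mkseq subn_gt0.
exists (fun n => word_at a 0 (s n).1.1), V, w; split => n.
- by rewrite /w; case: (s n) => [[i j] L]; rewrite divr_ge0.
- rewrite /V /w; case: (s n) (sP n) => [[i j] L] [ij iL per' _].
  exact: is_prefix_word_pow.
(* Here [U V] has length [j] and [U V^w] has length [i + (L - i) = L]. *)
- rewrite size_cat szV size_cat /V /len; case: (s n) (sP n) => [[i j] L] [ij iL _ rL] /=.
  rewrite !size_mkseq !subnKC ?(ltnW ij) // ler_pdivlMr // ltr0n.
  exact: leq_ltn_trans ij.
- move=> m nm; rewrite !szV.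
  exact: (homo_ltn (f := len \o s) ltn_trans slen).
Qed.

(** Prefixes taken to the power 1 suffice. The resulting bound [Dio >= 1] serves to absorb constants
    in the final estimate. *)
Lemma dio_cond1 (R : realType) (T : Type) (a : nat -> T) : dio_cond a (1 : R).
Proof.
apply: dio_cond_of_periods => N; exists 0%N, N.+1, N.+1.
by split => //; [lia|move=> k; lia|rewrite mul1r].
Qed.

Lemma dio_cond_of_w1 (R : realType) (F : finFieldType) (a : nat -> F)
    (n0 kappa : nat) (w : R) :
  (0 < kappa)%N -> (forall n, (n0 <= n)%N -> (complexity a n <= kappa * n)%N) ->
  (2 * kappa)%N%:R < w ->
  infinite_set [set P : {poly {poly F}} | (size P <= 2)%N /\
      0 < labs R (leval P (lseries a)) <= height R P `^ (- w)] ->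
  dio_cond a ((w + 1) / (2 * kappa)%N%:R).
Proof.
move=> k0 cpx kw infP; have w0 : 0 < w by apply: le_lt_trans kw.
apply: dio_cond_of_periods => N.
(* This size gives [d > n0 + N]: the complexity bound applies at [d.+1], and the run ending at
   [W + d] is longer than [N]. *)
have [P [P2 PN PH]] := infinite_linear_large_size (n0 + N).+1 (ltW w0) (@lseries_neg _ a) infP.
set d := (size (P`_1)%R).-1.
have q0 : P`_1 != 0 by rewrite -size_poly_gt0; apply: leq_trans PN.
have sd : size (P`_1)%R = d.+1 by rewrite prednK // size_poly_gt0.
have dN : (n0 + N < d)%N by move: PN; rewrite sd; lia.
have [|i [j [ij jb per]]] := @repeated_factor _ a d.+1 (kappa * d.+1).
  by apply: cpx; lia.
have fP := leval_small_coef (ltW w0) PH q0.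
pose W : int := Num.ceil (w * d%:R).
have f0 m : m < W -> leval P (lseries a) m = 0.
  by move=> mW; apply: fP; rewrite -/d -ceil_gt_int.
have d0 : 0 < d%:R :> R by rewrite ltr0n; lia.
(* The factor 2 comes from [d + 1 <= 2 d]. *)
have j2 : (j <= 2 * kappa * d)%N by apply: (leq_trans jb); nia.
have jw : j%:R < w * d%:R :> R.
  apply: (@le_lt_trans _ _ ((2 * kappa)%N%:R * d%:R)); last by rewrite ltr_pM2r.
  by rewrite -natrM ler_nat.
have jW : j%:Z < W by rewrite ceil_gt_int.
have qn : (size (P`_1)%R <= d.+1)%N by rewrite sd.
have := period_of_approximation qn ij per (leval_linear _ P2) q0 jW f0.
rewrite -/d => per'.
exists i, j, (`|W|%N + d)%N; split => //.
- lia.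
- by move=> k kL; apply: per'; lia.
have Wle : w * d%:R <= `|W|%N%:R.
  apply: le_trans (ceil_ge _) _.
  by rewrite -[X in _ <= X]/(`|W|%N%:Z%:~R) ler_int lez_abs.
apply: (@le_trans _ _ ((w + 1) * d%:R)); last first.
  by rewrite mulrDl mul1r natrD lerD2r.
rewrite -mulrA ler_pM2l ?addr_gt0 // mulrC ler_pdivrMr ?ltr0n ?muln_gt0 //.
by rewrite -natrM ler_nat mulnC.
Qed.

Unset Implicit Arguments.

Theorem theoremA2 (R : realType) (F : finFieldType) (a : nat -> F)
    (n0 kappa : nat) :
  ~ ultimately_periodic a ->
  (1 <= n0)%N ->
  (2 <= kappa)%N ->
  (forall n : nat, (n0 <= n)%N -> (complexity a n <= kappa * n)%N) ->
  Dio R a \is a fin_num ->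
  (w1 R (lseries a) <=
     (8 * (kappa + 1) ^ 2 * (2 * kappa + 1))%N%:R%:E * Dio R a - 1)%E.
Proof.
move=> _ _ k2 cpx Dfin; rewrite -(fineK Dfin); set D := fine _.
have DP rho : dio_cond a rho -> rho <= D.
  move=> h; rewrite -lee_fin fineK //; apply: ereal_sup_ubound.
  by exists rho.
have D1 := DP 1 (dio_cond1 R a).
set C := (8 * _ * _)%N.
have C2 : (2 * kappa + 1 <= C)%N by rewrite /C; nia.
apply: ge_ereal_sup => _ [w /= infP <-].
rewrite -EFinM -EFinB lee_fin leNgt; apply/negP => wC.
have CD : C%:R <= C%:R * D by rewrite ler_peMr.
(* Since [D >= 1], one has [w > C D - 1 >= C - 1 >= 2 kappa]. *)
have kw : (2 * kappa)%N%:R < w.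
  apply: le_lt_trans wC; rewrite lerBrDr.
  by apply: le_trans CD; rewrite natr1 ler_nat -addn1.
have k0 : (0 < 2 * kappa)%N by lia.
(* This yields [w + 1 <= 2 kappa D <= C D], against the choice of [w]. *)
have := DP _ (dio_cond_of_w1 (ltnW k2) cpx kw infP).
rewrite ler_pdivrMr ?ltr0n // leNgt => /negP; apply.
move: wC; rewrite ltrBlDr; apply: le_lt_trans.
rewrite mulrC ler_wpM2r ?(le_trans ler01) // ler_nat.
by move: C2; lia.
Qed.
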